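(* Let $0<q<1$. For all real $t,s>0$ and every $\alpha>0$, $$\mathrm{B}_q(t,s)=\int_0^{\infty/\alpha}\frac{1}{y\,\big(1+\frac{q}{y}\big)_q^t\,(1+y)_q^s}\,d_qy.$$
   Context: Fix $0<q<1$. Notation: $(1+a)_q^\infty=\prod_{j=0}^\infty(1+q^ja)$ and, for $t\in\mathbb C$, $(1+a)_q^t=\dfrac{(1+a)_q^\infty}{(1+q^ta)_q^\infty}$. Jackson integrals: for $a>0$, $\int_0^a f(x)\,d_qx=(1-q)\sum_{n\ge 0}q^na\,f(q^na)$; for $C>0$, $\int_0^{\infty/C}f(x)\,d_qx=(1-q)\sum_{n\in\mathbb Z}\frac{q^n}{C}f\big(\frac{q^n}{C}\big)$. The $q$-beta function is defined for $t,s>0$ by $\mathrm{B}_q(t,s)=\int_0^1x^{t-1}(1-qx)_q^{s-1}\,d_qx$. *)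

(* Defs.v *)
From HB Require Import structures.
From mathcomp Require Import all_boot all_order all_algebra.
From mathcomp Require Import all_classical all_reals all_analysis.

Set Implicit Arguments.
Unset Strict Implicit.
Unset Printing Implicit Defensive.

Import Order.TTheory GRing.Theory Num.Theory.
Import numFieldNormedType.Exports.

Local Open Scope classical_set_scope.
Local Open Scope ring_scope.

(* [qexp_inf q a] is (1+a)_q^oo; the product converges for every a as soon as
   0 < q < 1, so that [lim] is then the genuine limit. *)
Definition qexp_inf (R : realType) (q a : R) : R :=
  limn (fun n : nat => \prod_(j < n) (1 + q ^+ j * a)).

(* [qexp q a t] is (1+a)_q^t, for a real exponent t. A difference such as
   (1 - qx)_q^t is [qexp q (- (q * x)) t]. *)
Definition qexp (R : realType) (q a t : R) : R :=
  qexp_inf q a / qexp_inf q (q `^ t * a).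

(* A series indexed by the integers converges when its two halves
   (indices n >= 0 and indices n = -(m+1) <= -1) converge separately. *)
Definition cvg_bilateral (R : realType) (u : int -> R) : Prop :=
  cvgn (series (fun n : nat => u (Posz n))) /\
  cvgn (series (fun m : nat => u (Negz m))).

Definition bilateral_sum (R : realType) (u : int -> R) : R :=
  limn (series (fun n : nat => u (Posz n))) +
  limn (series (fun m : nat => u (Negz m))).

(* Jackson integral of f over [0, a] *)
Definition jackson_term (R : realType) (q a : R) (f : R -> R) (n : nat) : R :=
  q ^+ n * a * f (q ^+ n * a).

Definition jackson_integrable (R : realType) (q a : R) (f : R -> R) : Prop :=
  cvgn (series (jackson_term q a f)).

Definition jackson_integral (R : realType) (q a : R) (f : R -> R) : R :=
  (1 - q) * limn (series (jackson_term q a f)).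

(* Jackson integral of f over [0, oo/C]; here [q ^ n] has an integer exponent *)
Definition jackson_oo_term (R : realType) (q C : R) (f : R -> R) (n : int) : R :=
  q ^ n / C * f (q ^ n / C).

Definition jackson_oo_integrable (R : realType) (q C : R) (f : R -> R) : Prop :=
  cvg_bilateral (jackson_oo_term q C f).

Definition jackson_oo_integral (R : realType) (q C : R) (f : R -> R) : R :=
  (1 - q) * bilateral_sum (jackson_oo_term q C f).

Definition qbeta_integrand (R : realType) (q t s x : R) : R :=
  x `^ (t - 1) * qexp q (- (q * x)) (s - 1).

Definition qbeta (R : realType) (q t s : R) : R :=
  jackson_integral q 1 (qbeta_integrand q t s).

(* Main.v *)
Require Import Defs.
From HB Require Import structures.
From mathcomp Require Import all_boot all_order all_algebra.
From mathcomp Require Import all_classical all_reals all_analysis.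
From mathcomp Require Import ring lra.

Import Order.TTheory GRing.Theory Num.Theory.
Import numFieldNormedType.Exports.

Local Open Scope classical_set_scope.
Local Open Scope ring_scope.

(* Put x = q^t and b = q^s.  Both sides become series in x and b: the left one is
   the q-binomial type sum over n >= 0, the right one a bilateral sum of
   1psi1 type.  Each satisfies the contiguous relations
     (1 - b) S(x, b) = (1 - x b) S(x, q b),
     (1 - x) S(x, b) = (1 - x b) S(q x, b),
   so their ratio is unchanged under x -> q x and b -> q b.  Both are monotone in
   x and b, which makes the ratio the same for all (x, b), and at x = b = q the
   two sums are a geometric and a telescoping series, both equal to
   1 / (1 - q). *)

(** * Summation of termwise relations *)

(** The partial sums satisfy the summed relation exactly, by induction, and a shifted series loses
    its index-0 term. Termwise identities thereby become contiguous relations between sums. *)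
Lemma lim_series_recursion (R : realType) (u v : R^nat) (a b c d : R) :
    cvgn (series u) -> cvgn (series v) ->
    (forall n, a * u n.+1 + b * u n = c * v n.+1 + d * v n) ->
  a * (limn (series u) - u 0%N) + b * limn (series u) =
  c * (limn (series v) - v 0%N) + d * limn (series v).
Proof.
have shifted (w : R^nat) k l : cvgn (series w) ->
    (fun n => k * (series w n.+1 - w 0%N) + l * series w n) @ \oo -->
    k * (limn (series w) - w 0%N) + l * limn (series w).
  move=> cw; apply: cvgD; apply: cvgMl_tmp; last exact: cw.
  by apply: cvgB; [rewrite (cvg_shiftS (series w)) | exact: cvg_cst].
move=> cu cv uv; have := shifted u a b cu.
suff -> : (fun n => a * (series u n.+1 - u 0%N) + b * series u n) =
    (fun n => c * (series v n.+1 - v 0%N) + d * series v n).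
  by move=> /cvg_lim <- //; apply: cvg_lim => //; exact: shifted.
apply/funext; rewrite /series /=.
elim=> [|n IH]; first by rewrite !big_nat1 !big_geq //; ring.
have := uv n; move: IH; rewrite !(big_nat_recr n.+1) //= !(big_nat_recr n) //=.
set x := \sum_(0 <= i < n) u i; set y := \sum_(0 <= i < n) v i.
by lra.
Qed.

Lemma lim_series_comb (R : realType) (u v w : R^nat) (a b : R) :
    cvgn (series u) -> cvgn (series v) ->
    (forall n, w n = a * u n + b * v n) ->
  limn (series w) = a * limn (series u) + b * limn (series v).
Proof.
move=> cu cv wE; have -> : w = a *: u + b *: v by apply/funext => n; exact: wE.
rewrite lim_seriesD; [|exact: is_cvg_seriesZ..].
by rewrite !lim_seriesZ.
Qed.

(** * The infinite product (1+a)_q^oo: convergence, functional equation, positivity, monotonicity *)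

Section QExpInf.
Context (R : realType) (q : R) (hq0 : 0 < q) (hq1 : q < 1).

Let qn0 n : 0 < q ^+ n. Proof. exact: exprn_gt0. Qed.
Let qn1 n : q ^+ n <= 1. Proof. by apply: exprn_ile1; exact: ltW. Qed.

Let partial (a : R) (n : nat) := \prod_(j < n) (1 + q ^+ j * a).

(** Each factor obeys [1 + u <= expR u], and the exponents [q ^+ j * a] add up to a finite geometric
    sum. *)
Lemma partial_qexp_le_expR a n : 0 <= a ->
  partial a n <= expR (a / (1 - q) * (1 - q ^+ n)).
Proof.
move=> a0; rewrite /partial; elim: n => [|n IH].
  by rewrite big_ord0 expr0 subrr mulr0 expR0.
rewrite big_ord_recr /=.
have -> : a / (1 - q) * (1 - q ^+ n.+1) =
    a / (1 - q) * (1 - q ^+ n) + q ^+ n * a.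
  by rewrite exprS; field; rewrite subr_eq0 gt_eqF.
rewrite expRD ler_pM ?expR_ge1Dx // ?prodr_ge0 // => [i _|].
  by rewrite addr_ge0 // mulr_ge0 // ltW.
by rewrite addr_ge0 // mulr_ge0 // ltW.
Qed.

Lemma cvg_qexp_inf_ge0 a : 0 <= a -> cvgn (partial a).
Proof.
move=> a0; apply: nondecreasing_is_cvgn.
  apply/nondecreasing_seqP => n; rewrite /partial big_ord_recr /= ler_peMr //.
    by apply: prodr_ge0 => i _; rewrite addr_ge0 // mulr_ge0 // ltW.
  by rewrite lerDl mulr_ge0 // ltW.
exists (expR (a / (1 - q))) => _ [n _ <-].
apply: (le_trans (partial_qexp_le_expR _ _ a0)); rewrite ler_expR ler_piMr //.
  by rewrite divr_ge0 // subr_ge0 ltW.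
by rewrite gerBl ltW.
Qed.

Let factor_gt0 a j : -1 < a -> 0 < 1 + q ^+ j * a.
Proof.
move=> a1; case: (leP 0 a) => a0.
  by rewrite ltr_wpDr // mulr_ge0 // ltW.
have : q ^+ j * - a <= - a by rewrite ler_piMl // oppr_ge0 ltW.
lra.
Qed.

Lemma partial_qexp_gt0 a n : -1 < a -> 0 < partial a n.
Proof. by move=> a1; apply: prodr_gt0 => i _; exact: factor_gt0. Qed.

Lemma partial_qexp_nonincreasing a : -1 < a -> a <= 0 ->
  {homo partial a : n m / (n <= m)%N >-> m <= n}.
Proof.
move=> a1 a0; apply/nonincreasing_seqP => n.
rewrite /partial big_ord_recr /=; apply: ler_piMr.
  by apply: ltW; exact: partial_qexp_gt0.
by rewrite gerDl pmulr_rle0.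
Qed.

Lemma cvg_qexp_inf a : -1 < a -> cvgn (partial a).
Proof.
move=> a1; case: (leP 0 a) => a0; first exact: cvg_qexp_inf_ge0.
apply: nonincreasing_is_cvgn; first exact: partial_qexp_nonincreasing (ltW _).
by exists 0 => _ [n _ <-]; rewrite ltW // partial_qexp_gt0.
Qed.

(** Once the factor j = 0 is split off, the remaining factors are those of the product at
    [q * a]. *)
Lemma qexp_inf_rec a : -1 < a -> qexp_inf q a = (1 + a) * qexp_inf q (q * a).
Proof.
move=> a1; have qa1 : -1 < q * a.
  by have := factor_gt0 _ 1 a1; rewrite expr1; lra.
apply: cvg_lim => //; rewrite -(cvg_shiftS (partial a)).
suff -> : (fun n => partial a n.+1) = (fun n => (1 + a) * partial (q * a) n).
  by apply: cvgMl_tmp; exact: cvg_qexp_inf.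
apply/funext => n; rewrite /partial big_ord_recl /= expr0 mul1r; congr (_ * _).
by apply: eq_bigr => i _; rewrite /bump /= add1n exprSr mulrA.
Qed.

Lemma partial_qexp_le a n : 0 <= a -> partial a n <= qexp_inf q a.
Proof.
move=> a0; apply: (@nondecreasing_cvgn_le _ (partial a)).
  apply/nondecreasing_seqP => {}n; rewrite /partial big_ord_recr /= ler_peMr //.
    by apply: prodr_ge0 => i _; rewrite addr_ge0 // mulr_ge0 // ltW.
  by rewrite lerDl mulr_ge0 // ltW.
exact: cvg_qexp_inf_ge0.
Qed.

Lemma qexp_inf_ge1 a : 0 <= a -> 1 <= qexp_inf q a.
Proof. by move=> a0; have := partial_qexp_le _ 0 a0; rewrite /partial big_ord0. Qed.

(* Each factor obeys 1 / (1 - q^j b) <= 1 + q^j b / (1 - b), so the product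
   cannot vanish in the limit. *)
Lemma qexp_inf_gt0 a : -1 < a -> 0 < qexp_inf q a.
Proof.
move=> a1; case: (leP 0 a) => a0.
  by apply: (lt_le_trans ltr01); exact: qexp_inf_ge1.
have ua : 0 < 1 + a by lra.
set c := - a / (1 + a); have c0 : 0 <= c by rewrite divr_ge0 // ?oppr_ge0 ltW.
have E0 : 0 < qexp_inf q c by apply: (lt_le_trans ltr01); exact: qexp_inf_ge1.
apply: (@lt_le_trans _ _ (qexp_inf q c)^-1); first by rewrite invr_gt0.
apply: limr_ge; first exact: cvg_qexp_inf.
apply: nearW => n; rewrite -[leLHS]div1r ler_pdivrMr //.
apply: (@le_trans _ _ (partial a n * partial c n)); last first.
  by rewrite ler_wpM2l ?partial_qexp_le // ltW // partial_qexp_gt0.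
rewrite /partial -big_split /=.
apply: (big_ind (fun x => 1 <= x)) => // [x y|j _]; first exact: mulr_ege1.
rewrite [leRHS](_ : _ = 1 + q ^+ j * a ^+ 2 * (1 - q ^+ j) / (1 + a)).
  rewrite lerDl divr_ge0 ?(ltW ua) // mulr_ge0 ?subr_ge0 //.
  by rewrite mulr_ge0 ?sqr_ge0 // ltW.
by rewrite /c; field; rewrite gt_eqF.
Qed.

Lemma qexp_inf_le a b : -1 < a -> a <= b -> qexp_inf q a <= qexp_inf q b.
Proof.
move=> a1 ab; have b1 := lt_le_trans a1 ab.
apply: ler_lim; [exact: cvg_qexp_inf|exact: cvg_qexp_inf|].
apply: nearW => n; apply: ler_prod => i _.
by rewrite ltW ?factor_gt0 //= lerD2l ler_wpM2l // ltW.
Qed.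

End QExpInf.

(* Along (q^n x, q^n b) the ratio F / G is a constant c, while F and G are
   interlaced with their values along (q^n q, q^n q), where they agree; since
   G has a positive limit, c = 1. *)
Lemma contiguous_unique (R : realType) (q : R) (F G : R -> R -> R) (m : R) :
    0 < q -> q < 1 -> 0 < m ->
    (forall x b, 0 < x < 1 -> 0 < b < 1 ->
       (1 - b) * F x b = (1 - x * b) * F x (q * b)) ->
    (forall x b, 0 < x < 1 -> 0 < b < 1 ->
       (1 - x) * F x b = (1 - x * b) * F (q * x) b) ->
    (forall x b, 0 < x < 1 -> 0 < b < 1 ->
       (1 - b) * G x b = (1 - x * b) * G x (q * b)) ->
    (forall x b, 0 < x < 1 -> 0 < b < 1 ->
       (1 - x) * G x b = (1 - x * b) * G (q * x) b) ->
    (forall x b x' b', 0 < x -> x <= x' -> x' < 1 ->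
       0 < b -> b <= b' -> b' < 1 -> F x b <= F x' b') ->
    (forall x b x' b', 0 < x -> x <= x' -> x' < 1 ->
       0 < b -> b <= b' -> b' < 1 -> G x b <= G x' b') ->
    (forall x b, 0 < x < 1 -> 0 < b < 1 -> m <= G x b) ->
    F q q = G q q ->
  forall x b, 0 < x < 1 -> 0 < b < 1 -> F x b = G x b.
Proof.
move=> q0 q1 m0 Fb Fx Gb Gx Fle Gle Gm FGq.
have q01 : 0 < q < 1 by apply/andP.
have qn0 n : 0 < q ^+ n by rewrite exprn_gt0.
have qn1 n : q ^+ n <= 1 by apply: exprn_ile1; exact: ltW.
have scale n x : 0 < x < 1 -> 0 < q ^+ n * x < 1.
  move=> /andP[x0 x1]; rewrite mulr_gt0 //=.
  by apply: le_lt_trans x1; rewrite ler_piMl // ltW.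
have Gpos x b : 0 < x < 1 -> 0 < b < 1 -> 0 < G x b.
  by move=> x01 b01; apply: lt_le_trans m0 (Gm _ _ x01 b01).
have cross (k l f f' g g' : R) : k != 0 ->
    k * f = l * f' -> k * g = l * g' -> f * g' = f' * g.
  move=> k0 ff' gg'; apply: (mulfI k0).
  by rewrite mulrA ff' [RHS]mulrCA gg'; ring.
have ratio x b n : 0 < x < 1 -> 0 < b < 1 ->
    F (q ^+ n * x) (q ^+ n * b) =
    F x b / G x b * G (q ^+ n * x) (q ^+ n * b).
  move=> x01 b01; elim: n => [|n IH].
    by rewrite expr0 !mul1r divfK // gt_eqF // Gpos.
  rewrite !exprS -!mulrA.
  have := scale n x x01; have := scale n b b01.
  move: (q ^+ n * x) (q ^+ n * b) IH => u v IH v01 u01.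
  have qu01 := scale 1%N u u01; rewrite expr1 in qu01.
  have /andP[_ v1] := v01; have /andP[_ u1] := u01.
  have v1' : 1 - v != 0 by rewrite subr_eq0 gt_eqF.
  have u1' : 1 - u != 0 by rewrite subr_eq0 gt_eqF.
  (* The step from (u, v) to (q u, q v) passes through (q u, v): [Hx] moves the first argument, [Hb]
     the second. *)
  have Hb := cross _ _ _ _ _ _ v1' (Fb _ _ qu01 v01) (Gb _ _ qu01 v01).
  have Hx := cross _ _ _ _ _ _ u1' (Fx _ _ u01 v01) (Gx _ _ u01 v01).
  have g0 := Gpos _ _ u01 v01; have g1 := Gpos _ _ qu01 v01.
  apply: (mulIf (lt0r_neq0 g1)); rewrite -Hb.
  apply: (mulIf (lt0r_neq0 g0)); rewrite mulrAC -Hx IH; ring.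
move=> x b x01 b01; have /andP[x0 x1] := x01; have /andP[b0 b1] := b01.
(* A delay of [k] steps is enough to interlace the two diagonals: q^(n+k) (x, b) lies below q^n (q,
   q), and q^(n+k) (q, q) below q^n (x, b). *)
have [k [kx kb kq]] : exists k, [/\ q ^+ k <= x, q ^+ k <= b & q ^+ k <= q].
  have /cvgr0_norm_lt H : GRing.exp q @ \oo --> (0 : R).
    by apply: cvg_expr; rewrite gtr0_norm.
  have [k _ Hk] : \forall n \near \oo, [/\ q ^+ n < x, q ^+ n < b & q ^+ n < q].
    near=> n; split; rewrite -[ltLHS]gtr0_norm //; near: n; exact: H.
  by have [/ltW ? /ltW ? /ltW ?] := Hk k (leqnn k); exists k; split.
pose f n := F (q ^+ n * x) (q ^+ n * b); pose g n := G (q ^+ n * x) (q ^+ n * b).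
pose h n := G (q ^+ n * q) (q ^+ n * q).
(* On the diagonal through (q, q) the constant ratio is 1, so [h] can be compared with both [f] and
   [g]. *)
have hE n : F (q ^+ n * q) (q ^+ n * q) = h n.
  by rewrite ratio // FGq divff ?mul1r // gt_eqF // Gpos.
have below n z : 0 < z < 1 -> q ^+ (n + k) * z <= q ^+ n * q.
  move=> /andP[z0 z1]; rewrite exprD -mulrA ler_pM2l //.
  by apply: le_trans kq; rewrite ler_piMr // ltW.
have above n z : q ^+ k <= z -> q ^+ (n + k) * q <= q ^+ n * z.
  move=> kz; rewrite exprD -mulrA ler_pM2l //.
  by apply: le_trans kz; rewrite ler_piMr // ltW.
have lo n z : 0 < z < 1 -> 0 < q ^+ n * z by move=> z01; case/andP: (scale n z z01).
have hi n z : 0 < z < 1 -> q ^+ n * z < 1 by move=> z01; case/andP: (scale n z z01).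
have gh n : g (n + k)%N <= h n by apply: Gle; rewrite ?below ?lo ?hi.
have hg n : h (n + k)%N <= g n by apply: Gle; rewrite ?above ?lo ?hi.
have fh n : f (n + k)%N <= h n by rewrite -hE; apply: Fle; rewrite ?below ?lo ?hi.
have hf n : h (n + k)%N <= f n by rewrite -hE; apply: Fle; rewrite ?above ?lo ?hi.
set c := F x b / G x b.
have fE n : f n = c * g n by exact: ratio.
have gm n : m <= g n by apply: Gm; exact: scale.
have gpos n : 0 < g n by exact: lt_le_trans (gm n).
have g_dec : {homo g : n p / (n <= p)%N >-> p <= n}.
  apply/nonincreasing_seqP => n.
  by apply: Gle; rewrite ?lo ?hi // exprS -mulrA ler_piMl ?(ltW (lo _ _ _)) ?ltW.
have g_cvg : cvgn g.
  by apply: nonincreasing_is_cvgn => //; exists m => _ [n _ <-].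
have L0 : 0 < limn g.
  by apply: lt_le_trans m0 _; apply: limr_ge => //; exact: nearW.
have gL n : limn g <= g n by exact: nonincreasing_cvgn_ge.
(* Positivity of [F] is not assumed; it is inherited from [h k <= f 0]. *)
have c0 : 0 < c.
  rewrite -(pmulr_lgt0 _ (gpos 0%N)) -fE.
  by apply: lt_le_trans (hf 0%N); exact: Gpos (scale _ _ _) (scale _ _ _).
have cg_cvg : (fun n => c * g n) @ \oo --> c * limn g by exact: cvgMl_tmp.
(* The chain is lim g <= g (n+2k) <= h (n+k) <= f n = c g n; [le2] runs the same chain with [f] and
   [g] exchanged. The delay 2k disappears in the limit. *)
have le1 : limn g <= c * limn g.
  rewrite -(cvg_lim _ cg_cvg) //; apply: limr_ge; first exact: cvgP cg_cvg.
  apply: nearW => n; rewrite -fE.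
  by apply: le_trans (hf n); apply: le_trans (gh _); exact: gL.
have le2 : c * limn g <= limn g.
  apply: limr_ge => //; apply: nearW => n.
  apply: le_trans (hg n); apply: le_trans (fh _).
  by rewrite fE ler_wpM2l // ltW.
have c1 : c = 1.
  apply/eqP; rewrite eq_le -(ler_pM2r L0) mul1r le2.
  by rewrite -(ler_pM2r L0) mul1r le1.
by have := ratio x b 0%N x01 b01; rewrite -/c c1 expr0 !mul1r.
Unshelve. all: by end_near. Qed.

(** * The bilateral series of 1psi1 type *)

Section QBetaSeries.
Context (R : realType) (q : R) (hq0 : 0 < q) (hq1 : q < 1).

Local Notation E := (qexp_inf q).

Let qn0 n : 0 < q ^+ n. Proof. exact: exprn_gt0. Qed.
Let qn1 n : q ^+ n <= 1. Proof. by apply: exprn_ile1; exact: ltW. Qed.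

Let E_gt0 a : 0 < a -> 0 < E a.
Proof. by move=> a0; apply: qexp_inf_gt0 => //; lra. Qed.

Let E_rec a : 0 < a -> E a = (1 + a) * E (q * a).
Proof. by move=> a0; apply: qexp_inf_rec => //; lra. Qed.

(* With x = q^t and b = q^s this is y f(y), f the integrand on [0, oo/alpha]. *)
Definition psi_term (x b y : R) : R :=
  E (x * (q / y)) * E (b * y) / (E (q / y) * E y).

Lemma psi_term_gt0 x b y : 0 < x -> 0 < b -> 0 < y -> 0 < psi_term x b y.
Proof.
by move=> x0 b0 y0; rewrite /psi_term !(divr_gt0, mulr_gt0, E_gt0).
Qed.

(** The reflection exchanges the arguments [q / y] and [y], so exchanging [x] and [b] as well
    restores the term. *)
Lemma psi_term_inv x b y : 0 < y -> psi_term b x (q / y) = psi_term x b y.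
Proof.
move=> y0; rewrite /psi_term; have -> : q / (q / y) = y.
  by field; rewrite !gt_eqF.
by rewrite [X in X / _]mulrC [X in _ / X]mulrC.
Qed.

(** Each of the four products moves by one factor; [(1 + y) / (1 + 1 / y) = y] turns the factor
    [1 + x / y] into [x + y]. *)
Lemma psi_term_shift x b y : 0 < x -> 0 < b -> 0 < y ->
  psi_term x b (q * y) * (1 + b * y) = (x + y) * psi_term x b y.
Proof.
move=> x0 b0 y0; rewrite /psi_term.
have -> : q / (q * y) = 1 / y by field; rewrite !gt_eqF.
have y1 : 0 < 1 / y by rewrite divr_gt0.
have -> : b * (q * y) = q * (b * y) by ring.
have xy0 : 0 < x * (1 / y) by rewrite mulr_gt0.
have by0 : 0 < b * y by rewrite mulr_gt0.
rewrite (E_rec (x * (1 / y))) // (E_rec (1 / y)) // (E_rec (b * y)) // (E_rec y) //.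
have -> : q * (x * (1 / y)) = x * (q / y) by field; rewrite gt_eqF.
have -> : q * (1 / y) = q / y by field; rewrite gt_eqF.
have y2 : 0 < 1 + y by rewrite addr_gt0.
by field; rewrite !gt_eqF ?E_gt0 ?divr_gt0 ?mulr_gt0.
Qed.

(** Both terms on the left are multiples of p = [psi_term x (q * b) y], namely (1 + b y) p and (x +
    y) p; in (1 + b y) - b (x + y) the variable y cancels. *)
Lemma psi_term_contiguous x b y : 0 < x -> 0 < b -> 0 < y ->
  psi_term x b y - b * psi_term x b (q * y) =
  (1 - x * b) * psi_term x (q * b) y.
Proof.
move=> x0 b0 y0; have by0 : 0 < b * y by rewrite mulr_gt0.
have H := psi_term_shift x b y x0 b0 y0.
have K : psi_term x b y = (1 + b * y) * psi_term x (q * b) y.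
  by rewrite /psi_term (E_rec (b * y)) // !mulrA; ring.
have -> : psi_term x b (q * y) = (x + y) * psi_term x (q * b) y.
  apply: (@mulIf _ (1 + b * y)); first by rewrite gt_eqF //; lra.
  by rewrite H K; ring.
by rewrite K; ring.
Qed.

(* The ratio of consecutive terms is (x + y) / (1 + b y) <= x (1 + y / x), so
   the terms are O(x^n). *)
Lemma psi_term_le x b y n : 0 < x -> 0 < b -> 0 < y ->
  psi_term x b (q ^+ n * y) <= E (y / x) * psi_term x b y * x ^+ n.
Proof.
move=> x0 b0 y0; have yx0 : 0 < y / x by rewrite divr_gt0.
apply: (@le_trans _ _
  (* The induction needs the finite product; it is replaced by its upper bound [E (y / x)] only at
     the end. *)
  (\prod_(j < n) (1 + q ^+ j * (y / x)) * psi_term x b y * x ^+ n)); last first.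
  rewrite ler_wpM2r ?exprn_ge0 ?(ltW x0) // ler_wpM2r //.
    by rewrite ltW // psi_term_gt0.
  by apply: partial_qexp_le => //; exact: ltW.
elim: n => [|n IH]; first by rewrite big_ord0 !expr0 !mul1r mulr1.
have z0 : 0 < q ^+ n * y by rewrite mulr_gt0.
have bz0 : 0 < b * (q ^+ n * y) by rewrite mulr_gt0.
have T1 : 0 < psi_term x b (q ^+ n.+1 * y) by rewrite psi_term_gt0 // mulr_gt0.
apply: (@le_trans _ _ ((x + q ^+ n * y) * psi_term x b (q ^+ n * y))).
  rewrite -psi_term_shift // exprS -mulrA ler_peMr //.
    by rewrite mulrA -exprS ltW.
  by rewrite lerDl ltW.
rewrite big_ord_recr /= exprSr.
set p := \prod_(i < n) _ in IH *.
rewrite [leRHS](_ : _ = (x + q ^+ n * y) * (p * psi_term x b y * x ^+ n)).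
  by rewrite ler_wpM2l // ltW // addr_gt0.
by field; rewrite gt_eqF.
Qed.

Lemma cvg_psi_series x b y : 0 < x < 1 -> 0 < b -> 0 < y ->
  cvgn (series (fun n => psi_term x b (q ^+ n * y))).
Proof.
move=> /andP[x0 x1] b0 y0.
have K0 : 0 < E (y / x) * psi_term x b y.
  by apply: mulr_gt0; [exact/E_gt0/divr_gt0|exact: psi_term_gt0].
apply: (@series_le_cvg _ _ (geometric (E (y / x) * psi_term x b y) x)).
- by move=> n; apply: ltW; apply: psi_term_gt0 => //; exact: mulr_gt0.
- by move=> n /=; apply: mulr_ge0; rewrite ?exprn_ge0 ?ltW.
- by move=> n; exact: psi_term_le.
- by apply: is_cvg_geometric_series; rewrite gtr0_norm.
Qed.

Definition psi_half (x b y : R) : R :=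
  limn (series (fun n => psi_term x b (q ^+ n * y))).

(* The terms at the points q^n y with n < 0 are, by the symmetry y <-> q / y,
   those of the half series with x and b exchanged. *)
Definition psi_sum (x b y : R) : R := psi_half x b y + psi_half b x (q ^+ 2 / y).

(** The reflection swaps the two halves. It transfers the relation in [b] to one in [x]. *)
Lemma psi_sum_sym x b y : psi_sum b x (q ^+ 2 / y) = psi_sum x b y.
Proof.
rewrite /psi_sum addrC; congr (psi_half _ _ _ + _).
by rewrite invf_div mulrCA divff ?mulr1 // gt_eqF.
Qed.

(** Summed over all points q^n y with n an integer, [psi_term_contiguous] gives the claim, since y
    -> q y permutes these points. With two half series, the relation at y / q links the halves and
    is treated separately. *)
Lemma psi_sum_contiguous x b y : 0 < x < 1 -> 0 < b < 1 -> 0 < y ->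
  (1 - b) * psi_sum x b y = (1 - x * b) * psi_sum x (q * b) y.
Proof.
move=> x01 b01 y0; have /andP[x0 x1] := x01; have /andP[b0 b1] := b01.
have qb0 : 0 < q * b by rewrite mulr_gt0.
have qb1 : q * b < 1 by rewrite (lt_trans _ b1) // gtr_pMl.
have z0 : 0 < q ^+ 2 / y by rewrite divr_gt0.
have pos n : 0 < q ^+ n * y by rewrite mulr_gt0.
have zpos n : 0 < q ^+ n * (q ^+ 2 / y) by rewrite mulr_gt0.
(* The relation summed over the points q^n y with n >= 0. *)
have right_half : - b * (psi_half x b y - psi_term x b y) + psi_half x b y =
    (1 - x * b) * psi_half x (q * b) y.
  have := @lim_series_recursion R (fun n => psi_term x b (q ^+ n * y))
    (fun n => psi_term x (q * b) (q ^+ n * y)) (- b) 1 0 (1 - x * b)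
    (cvg_psi_series x b y x01 b0 y0) (cvg_psi_series x (q * b) y x01 qb0 y0).
  rewrite !expr0 !mul1r mul0r add0r; apply=> n.
  rewrite mul0r add0r -psi_term_contiguous // mul1r exprS mulrA; ring.
have qb01 : 0 < q * b < 1 by apply/andP.
(* The relation summed over the points q^n y with n <= -2. In reflected form the index grows away
   from y, so the roles of successive terms are reversed. *)
have left_half : 1 * (psi_half b x (q ^+ 2 / y) - psi_term b x (q ^+ 2 / y)) +
    - b * psi_half b x (q ^+ 2 / y) =
    (1 - x * b) * (psi_half (q * b) x (q ^+ 2 / y) -
    psi_term (q * b) x (q ^+ 2 / y)).
  have := @lim_series_recursion R
    (fun n => psi_term b x (q ^+ n * (q ^+ 2 / y)))
    (fun n => psi_term (q * b) x (q ^+ n * (q ^+ 2 / y)))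
    1 (- b) (1 - x * b) 0
    (cvg_psi_series b x _ b01 x0 z0) (cvg_psi_series (q * b) x _ qb01 x0 z0).
  rewrite !expr0 !mul1r mul0r addr0; apply=> n.
  (* Here w = q^(-n-2) y is the original point before reflection. *)
  have [w [w0 -> ->]] : exists w, [/\ 0 < w,
      q ^+ n.+1 * (q ^+ 2 / y) = q / w & q ^+ n * (q ^+ 2 / y) = q / (q * w)].
    exists (q / (q ^+ n.+1 * (q ^+ 2 / y))); rewrite (exprS q n).
    by split; [rewrite !(divr_gt0, mulr_gt0)|field; rewrite !gt_eqF..].
  rewrite (psi_term_inv x b) // (psi_term_inv x b) ?mulr_gt0 //.
  rewrite (psi_term_inv x (q * b)) //.
  by rewrite mul0r addr0 -psi_term_contiguous //; ring.
have yq0 : 0 < y / q by rewrite divr_gt0.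
(* The remaining relation, at y / q, whose reflection is [q ^+ 2 / y]. *)
have middle : psi_term b x (q ^+ 2 / y) - b * psi_term x b y =
    (1 - x * b) * psi_term (q * b) x (q ^+ 2 / y).
  have -> : q ^+ 2 / y = q / (y / q) by field; rewrite !gt_eqF.
  rewrite !psi_term_inv // -psi_term_contiguous //.
  by congr (_ - _ * psi_term _ _ _); field; rewrite gt_eqF.
by rewrite /psi_sum; move: right_half left_half middle; lra.
Qed.

Lemma psi_sum_contiguous_l x b y : 0 < x < 1 -> 0 < b < 1 -> 0 < y ->
  (1 - x) * psi_sum x b y = (1 - x * b) * psi_sum (q * x) b y.
Proof.
move=> x01 b01 y0; rewrite -psi_sum_sym -(psi_sum_sym (q * x)).
by rewrite psi_sum_contiguous // ?(mulrC x) // divr_gt0.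
Qed.

(** In each term [x] and [b] occur only in the numerator, through the increasing function [E]. *)
Lemma psi_half_le x b x' b' y : 0 < x -> x <= x' -> x' < 1 -> 0 < b -> b <= b' ->
  0 < y -> psi_half x b y <= psi_half x' b' y.
Proof.
move=> x0 xx' x'1 b0 bb' y0; have x'0 := lt_le_trans x0 xx'.
have b'0 := lt_le_trans b0 bb'.
apply: lim_series_le; [apply: cvg_psi_series..|] => //.
- by rewrite x0 (le_lt_trans xx').
- by rewrite x'0.
move=> n; set z := q ^+ n * y; have z0 : 0 < z by rewrite mulr_gt0.
have qz0 : 0 < q / z by rewrite divr_gt0.
have E_le a c : 0 < a -> a <= c -> 0 <= E a <= E c.
  by move=> a0 ac; rewrite ltW ?E_gt0 //= qexp_inf_le //; lra.
have D0 : 0 < E (q / z) * E z by rewrite mulr_gt0 ?E_gt0.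
rewrite /psi_term ler_pM2r ?invr_gt0 //.
have /andP[Ex0 Ex] : 0 <= E (x * (q / z)) <= E (x' * (q / z)).
  by apply: E_le; [exact: mulr_gt0|rewrite ler_pM2r].
have /andP[Eb0 Eb] : 0 <= E (b * z) <= E (b' * z).
  by apply: E_le; [exact: mulr_gt0|rewrite ler_pM2r].
exact: ler_pM.
Qed.

Lemma psi_sum_le x b x' b' y : 0 < x -> x <= x' -> x' < 1 ->
    0 < b -> b <= b' -> b' < 1 -> 0 < y ->
  psi_sum x b y <= psi_sum x' b' y.
Proof.
by move=> *; apply: lerD; apply: psi_half_le => //; rewrite divr_gt0.
Qed.

Lemma psi_half_qq y : 0 < y -> psi_half q q y = y / (q + y) / (1 - q).
Proof.
move=> y0; have q1 : 1 - q != 0 by rewrite subr_eq0 gt_eqF.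
(* At x = b = q the term at z is z / ((q + z) (1 + z)); its partial fractions give this primitive,
   up to an additive constant. *)
pose g (n : nat) : R := (1 - q)^-1 / (1 + q ^+ n * (y / q)).
have telE : (fun n => psi_term q q (q ^+ n * y)) = telescope g.
  apply/funext => n; rewrite /telescope /= /g.
  have z0 : 0 < q ^+ n * y by rewrite mulr_gt0.
  have qz0 : 0 < q / (q ^+ n * y) by rewrite divr_gt0.
  rewrite /psi_term (E_rec (q / (q ^+ n * y))) // (E_rec (q ^+ n * y)) //.
  rewrite (exprS q n); field.
  have [d1 d2] := (addr_gt0 hq0 z0, addr_gt0 ltr01 z0).
  have [d3 d4] := (E_gt0 _ (mulr_gt0 hq0 z0), E_gt0 _ (mulr_gt0 hq0 qz0)).
  by rewrite q1 !gt_eqF.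
rewrite /psi_half telE telescopeK.
have gcvg : g @ \oo --> (1 - q)^-1 / (1 + 0 * (y / q)).
  apply: cvgMl_tmp; apply: cvgV; first by rewrite mul0r addr0 oner_eq0.
  apply: cvgD; first exact: cvg_cst.
  by apply: cvgMr_tmp; apply: cvg_expr; rewrite gtr0_norm.
rewrite (@cvg_lim _ _ _ _ _ _ _ (cvgB gcvg (cvg_cst (g 0%N)))) // /g expr0.
by field; rewrite q1 !gt_eqF // addr_gt0.
Qed.

(** Up to the factor 1 / (1 - q), the halves contribute y / (q + y) and q / (q + y), so the
    dependence on y disappears. *)
Lemma psi_sum_qq y : 0 < y -> psi_sum q q y = (1 - q)^-1.
Proof.
move=> y0; rewrite /psi_sum !psi_half_qq ?divr_gt0 //.
by field; rewrite subr_eq0 !gt_eqF ?addr_gt0 ?mulr_gt0.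
Qed.

(** * The q-binomial series *)

(** With (a;q)_n the product of 1 - a q^j over j < n, this is (q;q)_oo / (b;q)_oo times the
    q-binomial term (b;q)_n / (q;q)_n x^n. *)
Definition binom_term (x b : R) (n : nat) : R :=
  x ^+ n * (E (- q ^+ n.+1) / E (- (b * q ^+ n))).

Definition binom_sum (x b : R) : R := limn (series (binom_term x b)).

Let Eneg_gt0 b n : 0 < b < 1 -> 0 < E (- (b * q ^+ n)).
Proof.
move=> /andP[b0 b1]; apply: qexp_inf_gt0 => //; rewrite ltrN2.
by apply: le_lt_trans b1; rewrite ler_piMr // ltW.
Qed.

Let Eq_gt0 n : 0 < E (- q ^+ n.+1).
Proof. by rewrite exprS; apply: Eneg_gt0; rewrite hq0. Qed.

Let Eneg_rec b n : 0 < b < 1 ->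
  E (- (b * q ^+ n)) = (1 - b * q ^+ n) * E (- (b * q ^+ n.+1)).
Proof.
move=> /andP[b0 b1]; rewrite qexp_inf_rec //.
  by congr (_ * E _); rewrite exprS; ring.
by rewrite ltrN2; apply: le_lt_trans b1; rewrite ler_piMr // ltW.
Qed.

Lemma binom_term_gt0 x b n : 0 < x -> 0 < b < 1 -> 0 < binom_term x b n.
Proof.
move=> x0 b01; apply: mulr_gt0; first exact: exprn_gt0.
by apply: divr_gt0; [exact: Eq_gt0|exact: Eneg_gt0].
Qed.

(** Monotonicity of [E] bounds the coefficient of x^n by [E 0 / E (- b)], leaving a geometric
    series. *)
Lemma cvg_binom_series x b : 0 < x < 1 -> 0 < b < 1 ->
  cvgn (series (binom_term x b)).
Proof.
move=> /andP[x0 x1] b01; have /andP[b0 b1] := b01.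
have Eb := Eneg_gt0 _ 0 b01; rewrite expr0 mulr1 in Eb.
apply: (@series_le_cvg _ _ (geometric (E 0 / E (- b)) x)).
- by move=> n; apply: ltW; exact: binom_term_gt0.
- move=> n /=; apply: mulr_ge0; last by rewrite exprn_ge0 ?ltW.
  by rewrite divr_ge0 // ltW // qexp_inf_gt0 // oppr_lt0.
- move=> n; rewrite /binom_term /= mulrC ler_wpM2r ?exprn_ge0 ?(ltW x0) //.
  apply: ler_pM; first exact/ltW/Eq_gt0.
  + by rewrite invr_ge0 ltW // Eneg_gt0.
  + apply: qexp_inf_le => //; last by rewrite oppr_le0 ltW.
    by rewrite ltrN2 exprS; apply: le_lt_trans hq1; rewrite ler_piMr // ltW.
  + rewrite lef_pV2 ?posrE // ?Eneg_gt0 //.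
    by apply: qexp_inf_le; rewrite // ?ltrN2 // lerN2 ler_piMr // ltW.
- by apply: is_cvg_geometric_series; rewrite gtr0_norm.
Qed.

(** The coefficients satisfy (1 - q^(n+1)) c_(n+1) = (1 - b q^n) c_n; multiplied by x^(n+1), this is
    the termwise relation. The index-0 terms agree and cancel. *)
Lemma binom_sum_contiguous_l x b : 0 < x < 1 -> 0 < b < 1 ->
  (1 - x) * binom_sum x b = (1 - x * b) * binom_sum (q * x) b.
Proof.
move=> x01 b01; have /andP[x0 x1] := x01.
have qx01 : 0 < q * x < 1.
  by rewrite mulr_gt0 //= (lt_trans _ x1) // gtr_pMl.
have := @lim_series_recursion R (binom_term x b) (binom_term (q * x) b)
  1 (- x) 1 (- (x * b)) (cvg_binom_series _ _ x01 b01)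
  (cvg_binom_series _ _ qx01 b01).
have -> : binom_term (q * x) b 0 = binom_term x b 0.
  by rewrite /binom_term !expr0.
rewrite -/(binom_sum x b) -/(binom_sum (q * x) b) => H.
suff /H : forall n, 1 * binom_term x b n.+1 + - x * binom_term x b n =
  1 * binom_term (q * x) b n.+1 + - (x * b) * binom_term (q * x) b n by lra.
move=> n; rewrite /binom_term (Eneg_rec b n b01).
have qq : E (- q ^+ n.+1) = (1 - q ^+ n.+1) * E (- q ^+ n.+2).
  by have := Eneg_rec q n; rewrite -!exprS hq0 => /(_ hq1).
rewrite qq !exprMn !exprS.
have f1 : 1 - b * q ^+ n != 0.
  have := Eneg_gt0 b n b01; rewrite (Eneg_rec b n b01) => h.
  by apply: contraTneq h => ->; rewrite mul0r ltxx.
have f2 : E (- (b * (q * q ^+ n))) != 0.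
  by rewrite -exprS gt_eqF // Eneg_gt0.
by field; rewrite f1 f2.
Qed.

(** Replacing b by q b multiplies c_n by 1 - b q^n, so S(x, q b) = S(x, b) - b S(q x, b); the
    relation in [x] then eliminates S(q x, b). *)
Lemma binom_sum_contiguous x b : 0 < x < 1 -> 0 < b < 1 ->
  (1 - b) * binom_sum x b = (1 - x * b) * binom_sum x (q * b).
Proof.
move=> x01 b01; have /andP[x0 x1] := x01; have /andP[b0 b1] := b01.
have qx01 : 0 < q * x < 1.
  by rewrite mulr_gt0 //= (lt_trans _ x1) // gtr_pMl.
have : binom_sum x (q * b) = 1 * binom_sum x b + - b * binom_sum (q * x) b.
  apply: lim_series_comb; [exact: cvg_binom_series..|] => n.
  rewrite /binom_term (Eneg_rec b n b01) (_ : q * b * q ^+ n = b * q ^+ n.+1).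
    have f1 : 1 - b * q ^+ n != 0.
      have := Eneg_gt0 b n b01; rewrite (Eneg_rec b n b01) => h.
      by apply: contraTneq h => ->; rewrite mul0r ltxx.
    have f2 : E (- (b * q ^+ n.+1)) != 0 by rewrite gt_eqF // Eneg_gt0.
    by rewrite exprMn; field; rewrite f1 f2.
  by rewrite exprS; ring.
move=> ->; have := binom_sum_contiguous_l x b x01 b01.
set F := binom_sum x b; set G := binom_sum (q * x) b => H.
have -> : (1 - x * b) * (1 * F + - b * G) = (1 - x * b) * F - b * ((1 - x * b) * G).
  by ring.
by rewrite -H; ring.
Qed.

Lemma binom_sum_le x b x' b' : 0 < x -> x <= x' -> x' < 1 ->
  0 < b -> b <= b' -> b' < 1 -> binom_sum x b <= binom_sum x' b'.
Proof.
move=> x0 xx' x'1 b0 bb' b'1; have x'0 := lt_le_trans x0 xx'.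
have b'0 := lt_le_trans b0 bb'.
have b01 : 0 < b < 1 by rewrite b0 (le_lt_trans bb').
have b'01 : 0 < b' < 1 by apply/andP.
apply: lim_series_le; [apply: cvg_binom_series => //..|].
- by rewrite x0 (le_lt_trans xx').
- by apply/andP.
move=> n; apply: ler_pM; rewrite ?exprn_ge0 ?(ltW x0) //.
- by apply: ltW; apply: divr_gt0; [exact: Eq_gt0|exact: Eneg_gt0].
- by rewrite lerXn2r // nnegrE ltW.
rewrite ler_pM2l ?Eq_gt0 // lef_pV2 ?posrE ?Eneg_gt0 //.
apply: qexp_inf_le => //; last by rewrite lerN2 ler_pM2r.
by rewrite ltrN2; apply: le_lt_trans b'1; rewrite ler_piMr // ltW.
Qed.

(** The term n = 0 alone is large enough, because [E (- b) <= E 0 = 1]. This is the uniform positive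
    bound for [contiguous_unique]. *)
Lemma binom_sum_ge x b : 0 < x < 1 -> 0 < b < 1 -> E (- q) <= binom_sum x b.
Proof.
move=> x01 b01; have /andP[x0 x1] := x01; have /andP[b0 b1] := b01.
have nd : {homo series (binom_term x b) : n m / (n <= m)%N >-> n <= m}.
  apply/nondecreasing_seqP => n; rewrite /series /= big_nat_recr //= lerDl.
  by apply: ltW; exact: binom_term_gt0.
apply: le_trans (nondecreasing_cvgn_le nd (cvg_binom_series _ _ x01 b01) 1%N).
rewrite /series /= big_nat1 /binom_term expr0 mul1r expr1 mulr1.
have Eb := Eneg_gt0 _ 0 b01; rewrite expr0 mulr1 in Eb.
have E1 := Eq_gt0 0; rewrite expr1 in E1.
rewrite ler_peMr ?(ltW E1) // invf_ge1 //.
rewrite (_ : 1 = E 0).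
  by apply: qexp_inf_le; rewrite // ?ltrN2 // oppr_le0 ltW.
apply/esym; rewrite /qexp_inf (_ : (fun n => _) = fun=> 1) ?lim_cst //.
by apply/funext => n; rewrite big1 // => i _; rewrite mulr0 addr0.
Qed.

Lemma binom_sum_qq : binom_sum q q = (1 - q)^-1.
Proof.
rewrite -[RHS]mul1r; apply: cvg_lim => //.
rewrite (_ : binom_term q q = geometric 1 q).
  by apply: cvg_geometric_series; rewrite gtr0_norm.
apply/funext => n; rewrite /binom_term /= -exprS divff ?mulr1 ?mul1r //.
by rewrite gt_eqF // Eq_gt0.
Qed.
End QBetaSeries.

(** * Identification of the two Jackson integrals with the series *)

Lemma powR_in01 (R : realType) (q t : R) :
  0 < q -> q < 1 -> 0 < t -> 0 < q `^ t < 1.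
Proof.
move=> q0 q1 t0; rewrite powR_gt0 //= (_ : 1 = 1 `^ t); last by rewrite powR1.
by apply: gt0_ltr_powR => //; rewrite nnegrE // ltW.
Qed.

(** At the node q^n the weight merges with the power into q^n (q^n)^(t-1) = (q^t)^n, and the
    denominator has argument -q^(s-1) q q^n = -q^s q^n. *)
Lemma jackson_term_qbetaE (R : realType) (q t s : R) : 0 < q -> 0 < t -> 0 < s ->
  jackson_term q 1 (qbeta_integrand q t s) = binom_term R q (q `^ t) (q `^ s).
Proof.
move=> q0 t0 s0; apply/funext => n.
have qn0 : 0 <= q ^+ n by rewrite exprn_ge0 // ltW.
rewrite /jackson_term /qbeta_integrand /qexp /binom_term !mulr1 mulrA.
rewrite mulr_powRB1 // -powR_mulrn ?(ltW q0) // -powRrM.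
rewrite -(powR_mulrn n (powR_ge0 q t)) -powRrM (mulrC t).
rewrite powR_mulrn ?(ltW q0) // -exprS -(mulr_powRB1 (ltW q0) s0) exprS.
by congr (_ * (_ / qexp_inf _ _)); ring.
Qed.

Theorem mainTheorem3 (R : realType) (q : R) (hq0 : 0 < q) (hq1 : q < 1)
    (t s : R) (ht : 0 < t) (hs : 0 < s) (alpha : R) (halpha : 0 < alpha) :
  let f := fun y : R => 1 / (y * qexp q (q / y) t * qexp q y s) in
  [/\ jackson_integrable q 1 (qbeta_integrand q t s),
      jackson_oo_integrable q alpha f
    & qbeta q t s = jackson_oo_integral q alpha f].
Proof.
move=> f; set x := q `^ t; set b := q `^ s; set y := alpha^-1.
have x01 : 0 < x < 1 by exact: powR_in01.
have b01 : 0 < b < 1 by exact: powR_in01.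
have /andP[x0 _] := x01; have /andP[b0 _] := b01.
have y0 : 0 < y by rewrite invr_gt0.
have z0 : 0 < q ^+ 2 / y by rewrite divr_gt0 ?exprn_gt0.
have fE z : 0 < z -> z * f z = psi_term R q x b z.
  move=> z0'; rewrite /f /psi_term /qexp -/x -/b !invfM !invrK mul1r -!mulrA.
  by rewrite mulVKf ?gt_eqF // mulrCA; congr (_ * _); rewrite mulrA mulrC.
have posE : (fun n => jackson_oo_term q alpha f (Posz n)) =
    (fun n => psi_term R q x b (q ^+ n * y)).
  by apply/funext => n; rewrite /jackson_oo_term fE // divr_gt0 ?exprn_gt0.
have negE : (fun n => jackson_oo_term q alpha f (Negz n)) =
    (fun n => psi_term R q b x (q ^+ n * (q ^+ 2 / y))).
  (* [Negz n] stands for -(n+1), and q / (q^(-n-1) y) = q^n (q^2 / y). *)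
  apply/funext => n; rewrite /jackson_oo_term /exprz -/y.
  have w0 : 0 < q ^- n.+1 * y by rewrite mulr_gt0 ?invr_gt0 ?exprn_gt0.
  rewrite fE // -psi_term_inv //; congr (psi_term _ _ _ _ _).
  by rewrite (exprS q n); field; rewrite !gt_eqF ?exprn_gt0.
split.
- by rewrite /jackson_integrable jackson_term_qbetaE //; exact: cvg_binom_series.
- by split; rewrite ?posE ?negE; exact: cvg_psi_series.
rewrite /qbeta /jackson_integral /jackson_oo_integral /bilateral_sum.
rewrite jackson_term_qbetaE // posE negE; congr (_ * _).
(* Here [y], hence [alpha], is a fixed parameter of the bilateral side; the binomial side plays [G]
   and supplies the lower bound. *)
apply/esym; apply: (@contiguous_unique R q
  (fun x b => psi_sum R q x b y) (binom_sum R q) (qexp_inf q (- q))) => //.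
- by apply: qexp_inf_gt0; rewrite // ltrN2.
- by move=> *; apply: psi_sum_contiguous.
- by move=> *; apply: psi_sum_contiguous_l.
- by move=> *; apply: binom_sum_contiguous.
- by move=> *; apply: binom_sum_contiguous_l.
- by move=> *; apply: psi_sum_le.
- by move=> *; apply: binom_sum_le.
- by move=> *; apply: binom_sum_ge.
- by rewrite psi_sum_qq // binom_sum_qq.
Qed.
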